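(* Let $G=\mathbb{Z}_{n_1}\times\mathbb{Z}_{n_2}\times\cdots\times\mathbb{Z}_{n_k}$ be a finite abelian group, and for $1\le i<j\le k$ let $d_{i,j}=\gcd(n_i,n_j)$. Then the number of associative $G$-graded twisted $\mathbb{C}$-algebras, up to graded isomorphism, is exactly $$d=\prod_{1\le i<j\le k}d_{i,j}.$$
   Context: Let $K$ be a field and $G$ a group with identity $e$. A $G$-graded twisted $K$-algebra is a (not necessarily associative) $K$-algebra $W$ with a $G$-grading $W=\bigoplus_{g\in G}W_g$, $W_aW_b\subset W_{ab}$, such that each $W_g$ is a one-dimensional $K$-vector space, $w_a\cdot w_b\neq 0$ for all nonzero $w_a\in W_a$, $w_b\in W_b$ (all $a,b\in G$), and $W$ has a multiplicative identity element $1\in W_e$. It is associative if its multiplication is associative. Two $G$-graded twisted $K$-algebras $W,V$ are graded-isomorphic if there is a unital $K$-algebra isomorphism $\varphi:W\to V$ with $\varphi(W_g)\subset V_g$ for all $g\in G$. $\mathbb{Z}_n$ denotes the cyclic group of order $n$. *)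

(* Defs.v *)
From HB Require Import structures.
From mathcomp Require Import all_boot all_order all_algebra all_fingroup.
From mathcomp Require Import classical_sets.

Set Implicit Arguments.
Unset Strict Implicit.
Unset Printing Implicit Defensive.

Import GRing.Theory.
Local Open Scope ring_scope.
Local Open Scope classical_set_scope.

(* The multiplication is not assumed associative, so it is given as a bare
   bilinear operation on an lmodType.  The index group is multiplicative and
   arbitrary; [gta_span] and [gta_free] together say that the carrier is the
   direct sum of its homogeneous components, using finite partial sums. *)
Record gradedTwistedAlg (K : fieldType) (G : groupType) := GradedTwistedAlg {
  gta_sort :> lmodType K;
  gta_mul : gta_sort -> gta_sort -> gta_sort;
  gta_one : gta_sort;
  gta_comp : G -> set gta_sort;
  gta_linear_l : forall v, linear (gta_mul^~ v);
  gta_linear_r : forall u, linear (gta_mul u);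
  gta_mul1l : left_id gta_one gta_mul;
  gta_mul1r : right_id gta_one gta_mul;
  gta_one_comp : gta_comp 1%g gta_one;
  gta_dim1 : forall g, exists2 w : gta_sort,
    w != 0 & gta_comp g = [set a *: w | a in [set: K]];
  gta_span : forall w : gta_sort, exists (s : seq G) (f : G -> gta_sort),
    (forall g, gta_comp g (f g)) /\ w = \sum_(g <- s) f g;
  gta_free : forall (s : seq G) (f : G -> gta_sort),
    uniq s -> (forall g, gta_comp g (f g)) -> \sum_(g <- s) f g = 0 ->
    forall g, g \in s -> f g = 0;
  gta_graded : forall a b u v,
    gta_comp a u -> gta_comp b v -> gta_comp (a * b)%g (gta_mul u v);
  gta_nondeg : forall a b u v, gta_comp a u -> gta_comp b v ->
    u != 0 -> v != 0 -> gta_mul u v != 0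
}.

Definition gta_associative (K : fieldType) (G : groupType)
    (W : gradedTwistedAlg K G) : Prop :=
  associative (@gta_mul K G W).

Definition graded_isomorphic (K : fieldType) (G : groupType)
    (W V : gradedTwistedAlg K G) : Prop :=
  exists phi : W -> V,
    [/\ linear phi, bijective phi,
        {morph phi : u v / gta_mul u v >-> gta_mul u v},
        phi (gta_one W) = gta_one V
      & forall g u, gta_comp g u -> gta_comp g (phi u)].

Lemma graded_isomorphic_refl (K : fieldType) (G : groupType) (W : gradedTwistedAlg K G) :
  graded_isomorphic W W.
Proof. by exists id; split => //; exists id. Qed.

Lemma graded_isomorphic_trans (K : fieldType) (G : groupType) (U V W : gradedTwistedAlg K G) :
  graded_isomorphic U V -> graded_isomorphic V W -> graded_isomorphic U W.
Proof.
move=> [f [lf bf mf f1 gf]] [g [lg bg mg g1 gg]]; exists (g \o f); split => /=.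
- by move=> a u v /=; rewrite lf lg.
- exact: bij_comp.
- by move=> u v /=; rewrite mf mg.
- by rewrite f1 g1.
- by move=> h u hu; apply/gg/gf.
Qed.

Lemma graded_isomorphic_sym (K : fieldType) (G : groupType) (V W : gradedTwistedAlg K G) :
  graded_isomorphic V W -> graded_isomorphic W V.
Proof.
move=> [f [lf [h fK hK] mf f1 gf]]; exists h.
have f0 : f 0 = 0 by have := lf (-1) 0 0; rewrite scaler0 addr0 scaleN1r addNr.
have lh : linear h by move=> a u v; apply: (can_inj fK); rewrite lf !hK.
split=> //.
- by exists f.
- by move=> u v; apply: (can_inj fK); rewrite mf !hK.
- by rewrite -f1 fK.
- move=> g u gu.
  have [v v0 Ev] := gta_dim1 V g; have [w w0 Ew] := gta_dim1 W g.
  have gv : gta_comp g v by rewrite Ev; exists 1 => //; rewrite scale1r.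
  have := gf _ _ gv; rewrite Ew => -[a _ aw].
  move: gu; rewrite Ew => -[b _ bw].
  have a0 : a != 0.
    apply: contraNneq v0 => a0; apply/eqP/(can_inj fK).
    by rewrite f0 -aw a0 scale0r.
  rewrite Ev; exists (b / a) => //.
  apply: (can_inj fK); rewrite hK -bw.
  have := lf (b/a) v 0; rewrite f0 !addr0 => ->.
  by rewrite -aw scalerA divfK.
Qed.

(* Used with E an equivalence relation: the objects satisfying P fall into
   exactly d classes for E, i.e. there is a system of d pairwise inequivalent
   representatives. *)
Definition has_exactly_classes (T : Type) (P : T -> Prop)
    (E : T -> T -> Prop) (d : nat) : Prop :=
  exists A : 'I_d -> T,
    [/\ forall i, P (A i),
        forall i j, E (A i) (A j) -> i = j
      & forall x, P x -> exists i, E x (A i)].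

(* Z_{n_0} x ... x Z_{n_{k-1}} with the componentwise group law.  For n > 0
   the type 'I_n.-1.+1 is 'I_n with addition mod n as group law; unlike 'Z_n
   it is also correct for n = 1. *)
Definition prod_cyclic (k : nat) (n : 'I_k -> nat) : finGroupType :=
  {dffun forall i : 'I_k, 'I_(n i).-1.+1}.

(* Main.v *)
Require Import Defs.
From HB Require Import structures.
From mathcomp Require Import all_boot all_order all_algebra all_fingroup.
From mathcomp Require Import cyclic separable cyclotomic.
From mathcomp Require Import boolp classical_sets.
From mathcomp Require Import reals complex.

Set Implicit Arguments.
Unset Strict Implicit.
Unset Printing Implicit Defensive.

Import GRing.Theory Num.Theory.
Local Open Scope ring_scope.

(** Associative graded twisted algebras over an abelian group G are classified
    by how their homogeneous elements commute.  Let e_i generate the i-th factor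
    of G, of order n_i, and let u, v be nonzero of degrees e_i, e_j with i < j.
    Both u v and v u span the line of degree e_i e_j, so v u = w_ij u v for a
    scalar w_ij that does not depend on u and v
    ([skew_commutation_exists]).  It is an invariant of the graded isomorphism
    class ([skew_commutation_iso], [skew_commutation_unique]).  Since u^n_i and
    v^n_j are nonzero multiples of 1, hence central, w_ij is a root of unity of
    order dividing both n_i and n_j ([commutator_root_of_unity]), that is,
    w_ij^gcd(n_i, n_j) = 1.

    Every such family w occurs: the bicharacter
    (g, h) |-> prod_(i < j) w_ij^(g_j h_i) is a 2-cocycle, and the group algebra
    twisted by it has commutation scalars w ([bicharacter_algebra_skew]).

    Finally w determines the algebra ([bicharacter_algebra_complete]): over an
    algebraically closed field each generator x_i of degree e_i can be rescaled
    so that x_i^n_i = 1; the ordered monomials b_g = x_0^g_0 x_1^g_1 ... then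
    form a homogeneous basis, and sorting the product b_g b_h
    ([ordered_monomial_mul]) produces exactly the bicharacter of w.

    So the classes correspond to families w, and as there are gcd(n_i, n_j)
    choices for each w_ij, their number is the product of these gcds. *)

(** * The group algebra twisted by a cocycle *)

Section TwistedGroupAlgebra.
Variables (K : fieldType) (G : finGroupType).

Record normalized_cocycle (f : G -> G -> K) : Prop := NormalizedCocycle {
  cocycle_neq0 : forall a b, f a b != 0;
  cocycle1l : forall a, f 1%g a = 1;
  cocycle1r : forall a, f a 1%g = 1;
  cocycleM : forall a b c, f a b * f (a * b)%g c = f b c * f a (b * c)%g
}.

Variables (f : G -> G -> K) (hf : normalized_cocycle f).

Local Notation V := {ffun G -> K^o}.

Definition twisted_basis (g : G) : V := [ffun h => (h == g)%:R].

(** The product in which the basis multiplies by g h = f(g, h) gh, written as a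
    convolution so that its bilinearity is visible. *)
Definition twisted_mul (u v : V) : V :=
  [ffun g => \sum_h f h (h^-1 * g)%g * (u h * v (h^-1 * g)%g)].

Definition twisted_comp (g : G) : set V := fun u => forall h, h != g -> u h = 0.

Lemma twisted_basis_comp g : twisted_comp g (twisted_basis g).
Proof. by move=> h /negPf hg; rewrite ffunE hg. Qed.

Lemma twisted_compP g u : twisted_comp g u <-> u = u g *: twisted_basis g.
Proof.
split=> [gu | -> h]; last first.
  by move=> /negPf hg; rewrite !ffunE hg scaler0.
apply/ffunP=> h; rewrite !ffunE; case: eqVneq => [-> | /gu ->].
  by rewrite /GRing.scale /= mulr1.
by rewrite scaler0.
Qed.

Lemma twisted_mul_linear_l v : linear (twisted_mul^~ v).
Proof.
move=> a u u'; apply/ffunP=> g; rewrite !ffunE scaler_sumr -big_split /=.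
apply: eq_bigr => h _; rewrite !ffunE /GRing.scale /= !mulrDl !mulrDr.
by congr (_ + _); rewrite -mulrA mulrCA.
Qed.

Lemma twisted_mul_linear_r u : linear (twisted_mul u).
Proof.
move=> a v v'; apply/ffunP=> g; rewrite !ffunE scaler_sumr -big_split /=.
apply: eq_bigr => h _; rewrite !ffunE /GRing.scale /= !mulrDr.
by congr (_ + _); rewrite !(mulrCA _ a).
Qed.

Lemma twisted_mul_comp a b u v : twisted_comp a u -> twisted_comp b v ->
  twisted_mul u v = (f a b * (u a * v b)) *: twisted_basis (a * b)%g.
Proof.
move=> ua vb; apply/ffunP=> g; rewrite !ffunE (bigD1 a) //= big1 => [|h ha].
  rewrite addr0 /GRing.scale /=; case: eqVneq => [-> | gab].
    by rewrite mulKg mulr1.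
  by rewrite vb ?mulr0 // (can2_eq (mulKVg a) (mulKg a)).
by rewrite ua // mul0r mulr0.
Qed.

Lemma twisted_mul1l : left_id (twisted_basis 1%g) twisted_mul.
Proof.
move=> u; apply/ffunP=> g; rewrite ffunE (bigD1 1%g) //= big1 => [|h h1].
  by rewrite (cocycle1l hf) ffunE eqxx addr0 !mul1r invg1 mul1g.
by rewrite twisted_basis_comp // mul0r mulr0.
Qed.

Lemma twisted_mul1r : right_id (twisted_basis 1%g) twisted_mul.
Proof.
move=> u; apply/ffunP=> g; rewrite ffunE (bigD1 g) //= big1 => [|h hg].
  by rewrite mulVg (cocycle1r hf) ffunE eqxx addr0 mul1r mulr1.
rewrite [twisted_basis _ _]twisted_basis_comp ?mulr0 //.
by apply: contraNneq hg => hg1; rewrite -[g](mulKVg h) hg1 mulg1.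
Qed.

(** Both sides are double sums over the factorizations of g into three elements
    a, b, c; they agree term by term because of the cocycle identity. *)
Lemma twisted_mulA : associative twisted_mul.
Proof.
move=> u v w; apply/ffunP=> g; rewrite !ffunE.
(* Here l is the first factor and h the product of the first two. *)
transitivity (\sum_l \sum_h f l (l^-1 * g)%g * (u l *
    (f (l^-1 * h)%g (h^-1 * g)%g * (v (l^-1 * h)%g * w (h^-1 * g)%g)))).
  apply: eq_bigr => l _; rewrite ffunE -!mulr_sumr; congr (_ * (_ * _)).
  rewrite (reindex_inj (mulgI l^-1%g)) /=; apply: eq_bigr => h _.
  by rewrite invMg invgK -!mulgA mulKVg.
rewrite exchange_big /=; apply: eq_bigr => h _.
rewrite ffunE mulr_suml mulr_sumr; apply: eq_bigr => l _.
have := cocycleM hf l (l^-1 * h)%g (h^-1 * g)%g.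
rewrite mulKVg -mulgA mulKVg => E.
rewrite [RHS](_ : _ = (f l (l^-1 * h)%g * f h (h^-1 * g)%g) *
  (u l * (v (l^-1 * h)%g * w (h^-1 * g)%g))); last first.
  by rewrite -!mulrA mulrCA !mulrA.
by rewrite E [f _ _ * f l _]mulrC -mulrA; congr (_ * _); rewrite mulrCA.
Qed.

Lemma twisted_basis_neq0 g : twisted_basis g != 0.
Proof. by apply/eqP => /ffunP/(_ g)/eqP; rewrite !ffunE eqxx oner_eq0. Qed.

Lemma twisted_dim1 g : exists2 w : V,
  w != 0 & twisted_comp g = [set a *: w | a in [set: K]]%classic.
Proof.
exists (twisted_basis g); first exact: twisted_basis_neq0.
apply/seteqP; split=> u => [/twisted_compP -> | [a _ <-] h hg]; first by exists (u g).
by rewrite ffunE twisted_basis_comp // scaler0.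
Qed.

Lemma twisted_span (w : V) : exists (s : seq G) (c : G -> V),
  (forall g, twisted_comp g (c g)) /\ w = \sum_(g <- s) c g.
Proof.
exists (enum G), (fun g => w g *: twisted_basis g); split.
  by move=> g; apply/twisted_compP; rewrite !ffunE eqxx /GRing.scale /= mulr1.
apply/ffunP=> g; rewrite sum_ffunE big_enum (bigD1 g) //= big1 => [|h hg].
  by rewrite !ffunE eqxx addr0 /GRing.scale /= mulr1.
by rewrite !ffunE eq_sym (negPf hg) scaler0.
Qed.

Lemma twisted_free (s : seq G) (c : G -> V) :
  uniq s -> (forall g, twisted_comp g (c g)) -> \sum_(g <- s) c g = 0 ->
  forall g, g \in s -> c g = 0.
Proof.
move=> s_uniq cP c0 g gs; move/ffunP/(_ g): c0.
rewrite sum_ffunE (bigD1_seq g) //= big1 => [|h hg]; last by rewrite cP 1?eq_sym.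
by rewrite addr0 ffunE => cg0; rewrite (iffLR (twisted_compP _ _) (cP g)) cg0 scale0r.
Qed.

Lemma twisted_graded a b u v : twisted_comp a u -> twisted_comp b v ->
  twisted_comp (a * b)%g (twisted_mul u v).
Proof.
move=> ua vb; rewrite (twisted_mul_comp ua vb).
by move=> g gab; rewrite ffunE twisted_basis_comp // scaler0.
Qed.

Lemma twisted_nondeg a b u v : twisted_comp a u -> twisted_comp b v ->
  u != 0 -> v != 0 -> twisted_mul u v != 0.
Proof.
move=> ua vb; rewrite (twisted_mul_comp ua vb).
rewrite (iffLR (twisted_compP _ _) ua) (iffLR (twisted_compP _ _) vb).
rewrite !scaler_eq0 !negb_or => /andP[u0 _] /andP[v0 _].
rewrite twisted_basis_neq0 andbT !ffunE !eqxx /GRing.scale /= !mulr1.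
by rewrite !mulf_neq0 // (cocycle_neq0 hf).
Qed.

Definition twisted_algebra : gradedTwistedAlg K G :=
  GradedTwistedAlg twisted_mul_linear_l twisted_mul_linear_r
    twisted_mul1l twisted_mul1r (@twisted_basis_comp 1%g) twisted_dim1
    twisted_span twisted_free twisted_graded twisted_nondeg.

Lemma twisted_algebra_associative : gta_associative twisted_algebra.
Proof. exact: twisted_mulA. Qed.

End TwistedGroupAlgebra.

(** * Homogeneous components *)

Lemma linear_fun0 (K : fieldType) (U V : lmodType K) (phi : U -> V) :
  linear phi -> phi 0 = 0.
Proof. by move=> /(_ (-1) 0 0); rewrite scaler0 addr0 scaleN1r addNr. Qed.

Section HomogeneousComponents.
Variables (K : fieldType) (G : groupType) (W : gradedTwistedAlg K G).
Implicit Types (u v w : W) (g : G).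

Lemma gta_comp_scale g a u : gta_comp g u -> gta_comp g (a *: u).
Proof.
have [w _ ->] := gta_dim1 W g.
by move=> [b _ <-]; exists (a * b) => //; rewrite scalerA.
Qed.

(** This is how one-dimensionality of the components is used below: elements of
    the same degree are proportional as soon as the first is nonzero. *)
Lemma gta_comp_line g u v :
  gta_comp g u -> u != 0 -> gta_comp g v -> exists a, v = a *: u.
Proof.
have [w _ ->] := gta_dim1 W g; move=> [b _ <-] bw0 [a _ <-].
have b0 : b != 0 by apply: contraNneq bw0 => ->; rewrite scale0r.
by exists (a / b); rewrite scalerA divfK.
Qed.

Lemma gta_mul_suml (I : Type) (s : seq I) (a : I -> K) (u : I -> W) v :
  gta_mul (\sum_(i <- s) a i *: u i) v = \sum_(i <- s) a i *: gta_mul (u i) v.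
Proof.
elim: s => [|i s IH]; last by rewrite !big_cons gta_linear_l IH.
by rewrite !big_nil; apply: linear_fun0 (gta_linear_l v).
Qed.

Lemma gta_mul_sumr (I : Type) (s : seq I) (a : I -> K) (u : I -> W) v :
  gta_mul v (\sum_(i <- s) a i *: u i) = \sum_(i <- s) a i *: gta_mul v (u i).
Proof.
elim: s => [|i s IH]; last by rewrite !big_cons gta_linear_r IH.
by rewrite !big_nil; apply: linear_fun0 (gta_linear_r v).
Qed.

Lemma gta_one_neq0 : gta_one W != 0.
Proof.
have [w w0 _] := gta_dim1 W 1%g; apply: contraNneq w0 => e0.
rewrite -(gta_mul1l w) e0.
by apply/eqP; apply: linear_fun0 (gta_linear_l w).
Qed.

End HomogeneousComponents.

(** * An associative algebra as a ring *)

Section RingStructure.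
Variables (K : fieldType) (G : groupType) (W : gradedTwistedAlg K G).

(** A copy of the carrier indexed by the associativity proof, so that the ring
    structure built from that proof can be inferred from the type. *)
Definition assoc_ring (WA : gta_associative W) : Type := W.

Variable WA : gta_associative W.
Local Notation A := (assoc_ring WA).

HB.instance Definition _ := GRing.Lmodule.on A.

Lemma assoc_ring_mulDl : left_distributive (@gta_mul K G W) +%R.
Proof. by move=> u v w; have := @gta_linear_l _ _ W w 1 u v; rewrite !scale1r. Qed.

Lemma assoc_ring_mulDr : right_distributive (@gta_mul K G W) +%R.
Proof. by move=> u v w; have := @gta_linear_r _ _ W u 1 v w; rewrite !scale1r. Qed.

HB.instance Definition _ := GRing.Zmodule_isNzRing.Build A
  (WA : associative (_ : A -> A -> A))
  (@gta_mul1l K G W) (@gta_mul1r K G W) assoc_ring_mulDl assoc_ring_mulDr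
  (@gta_one_neq0 K G W).

Lemma assoc_ring_scalerAl (a : K) (u v : A) : a *: (u * v) = a *: u * v.
Proof.
have := @gta_linear_l _ _ W v a u 0; have /= := mul0r v; rewrite /GRing.mul /= => E.
by rewrite E !addr0.
Qed.

HB.instance Definition _ := GRing.Lmodule_isLalgebra.Build K A assoc_ring_scalerAl.

Lemma assoc_ring_scalerAr (a : K) (u v : A) : a *: (u * v) = u * (a *: v).
Proof.
have := @gta_linear_r _ _ W u a v 0; have /= := mulr0 u; rewrite /GRing.mul /= => E.
by rewrite E !addr0.
Qed.

HB.instance Definition _ := GRing.Lalgebra_isAlgebra.Build K A assoc_ring_scalerAr.

Definition assoc_comp (g : G) : set A := @gta_comp K G W g.

Lemma assoc_comp1 : assoc_comp 1%g 1. Proof. exact: gta_one_comp. Qed.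

Lemma assoc_compM a b (u v : A) :
  assoc_comp a u -> assoc_comp b v -> assoc_comp (a * b)%g (u * v).
Proof. exact: gta_graded. Qed.

Lemma assoc_compX a (u : A) m : assoc_comp a u -> assoc_comp (a ^+ m)%g (u ^+ m).
Proof.
move=> au; elim: m => [|m IH]; first exact: assoc_comp1.
by rewrite expgS exprS; apply: assoc_compM.
Qed.

Lemma assoc_comp_prod (I : Type) (s : seq I) (a : I -> G) (u : I -> A) :
  (forall i, assoc_comp (a i) (u i)) ->
  assoc_comp (\prod_(i <- s) a i)%g (\prod_(i <- s) u i).
Proof.
move=> au; elim: s => [|i s IH]; first by rewrite !big_nil; exact: assoc_comp1.
by rewrite !big_cons; apply: assoc_compM.
Qed.

Lemma assoc_mul_neq0 a b (u v : A) : assoc_comp a u -> assoc_comp b v ->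
  u != 0 -> v != 0 -> u * v != 0.
Proof. exact: gta_nondeg. Qed.

Lemma assoc_exp_neq0 a (u : A) m : assoc_comp a u -> u != 0 -> u ^+ m != 0.
Proof.
move=> au u0; elim: m => [|m IH]; first exact: oner_neq0.
by rewrite exprS (assoc_mul_neq0 au (assoc_compX m au)).
Qed.

Lemma assoc_prod_neq0 (I : Type) (s : seq I) (a : I -> G) (u : I -> A) :
  (forall i, assoc_comp (a i) (u i)) -> (forall i, u i != 0) ->
  \prod_(i <- s) u i != 0.
Proof.
move=> au u0; elim: s => [|i s IH]; first by rewrite big_nil oner_neq0.
by rewrite big_cons (assoc_mul_neq0 (au i) (assoc_comp_prod s au)).
Qed.

End RingStructure.

(** * Recognizing a twisted group algebra *)

Section Recognition.
Variables (K : fieldType) (G : finGroupType) (f : G -> G -> K).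
Variables (hf : normalized_cocycle f) (W : gradedTwistedAlg K G) (b : G -> W).
Hypotheses (b_comp : forall g, gta_comp g (b g)) (b_neq0 : forall g, b g != 0).
Hypotheses (b1 : b 1%g = gta_one W).
Hypothesis bM : forall g h, gta_mul (b g) (b h) = f g h *: b (g * h)%g.

(** The isomorphism sends the basis vector of degree g to b g.  It is injective
    because the components are independent, and surjective because each of them
    is a line spanned by b g. *)
Lemma twisted_algebra_iso : graded_isomorphic W (twisted_algebra hf).
Proof.
apply: graded_isomorphic_sym.
pose phi (u : {ffun G -> K^o}) : W := \sum_g (u g : K) *: b g.
have phi_lin : linear phi.
  move=> a u v; rewrite /phi scaler_sumr -big_split /=; apply: eq_bigr => g _.
  by rewrite !ffunE scalerDl scalerA.
have phi_basis g : phi (twisted_basis K g) = b g.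
  rewrite /phi (bigD1 g) //= big1 => [|h hg]; last first.
    by rewrite twisted_basis_comp // scale0r.
  by rewrite ffunE eqxx addr0 scale1r.
have phi0 : phi 0 = 0 by apply: linear_fun0.
have phiD u v : phi (u + v) = phi u + phi v.
  by have := phi_lin 1 u v; rewrite !scale1r.
have phiZ a u : phi (a *: u) = a *: phi u.
  by have := phi_lin a u 0; rewrite phi0 !addr0.
have phi_inj u v : phi u = phi v -> u = v.
  move=> uv; apply/ffunP => g.
  have : phi (u - v) = 0 by rewrite -scaleN1r phiD phiZ uv scaleN1r subrr.
  rewrite /phi -big_enum /= => /(gta_free (enum_uniq _)) W0.
  have /eqP := W0 (fun h => gta_comp_scale _ (b_comp h)) g (mem_enum G g).
  by rewrite !ffunE scaler_eq0 (negPf (b_neq0 g)) orbF subr_eq0 => /eqP.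
have phi_surj w : exists u, phi u = w.
  have [s [c [cP ->]]] := gta_span w.
  elim: s => [|g s [u us]]; first by exists 0; rewrite big_nil.
  have [a ca] := gta_comp_line (b_comp g) (b_neq0 g) (cP g).
  by exists (a *: twisted_basis K g + u); rewrite phi_lin phi_basis us big_cons ca.
have [psi psiK] := choice phi_surj.
exists phi; split => //.
- by exists psi => // u; apply: phi_inj; rewrite psiK.
- move=> u v; rewrite /phi gta_mul_suml.
  under eq_bigr do rewrite ffunE scaler_suml.
  rewrite exchange_big /=; apply: eq_bigr => h _.
  rewrite gta_mul_sumr scaler_sumr (reindex_inj (mulgI h)); apply: eq_bigr => l _.
  by rewrite mulKg bM !scalerA mulrC.
- by rewrite -b1; exact: phi_basis.
- by move=> g u /twisted_compP ->; rewrite phiZ phi_basis; apply: gta_comp_scale.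
Qed.

End Recognition.

(** * Ordered monomials in skew-commuting elements *)

Section OrderedMonomials.
Variables (K : fieldType) (A : algType K).

Lemma skew_commute_exp (x y : A) (c : K) (s t : nat) :
  y * x = c *: (x * y) -> y ^+ s * x ^+ t = c ^+ (s * t) *: (x ^+ t * y ^+ s).
Proof.
move=> yx; have yXx : y ^+ s * x = c ^+ s *: (x * y ^+ s).
  elim: s => [|s IH]; first by rewrite mul1r mulr1 scale1r.
  by rewrite exprS -mulrA IH -scalerAr !mulrA yx -scalerAl scalerA exprSr.
elim: t => [|t IH]; first by rewrite muln0 mul1r mulr1 scale1r.
rewrite exprSr mulrA IH -scalerAl -[in LHS]mulrA yXx -scalerAr scalerA mulrA.
by rewrite -exprD mulnS addnC.
Qed.

(** To sort the product, each x_j of the first monomial must cross every x_i with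
    i < j of the second one; this happens a_j b_i times and each crossing costs
    w_ij. *)
Lemma ordered_monomial_mul k (x : 'I_k -> A) (w : 'I_k -> 'I_k -> K)
    (a b : 'I_k -> nat) :
  (forall i j : 'I_k, (i < j)%N -> x j * x i = w i j *: (x i * x j)) ->
  (\prod_i x i ^+ a i) * (\prod_i x i ^+ b i) =
  (\prod_(i < k) \prod_(j < k | (i < j)%N) w i j ^+ (a j * b i)) *:
    \prod_i x i ^+ (a i + b i).
Proof.
elim: k => [|k IH] in x w a b *; first by rewrite !big_ord0 mulr1 scale1r.
move=> xx; rewrite !big_ord_recl.
(* Moving a power of the first generator in front of the remaining ones. *)
have tail_head (s : seq 'I_k) m :
    (\prod_(i <- s) x (lift ord0 i) ^+ a (lift ord0 i)) * x ord0 ^+ m =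
    (\prod_(i <- s) w ord0 (lift ord0 i) ^+ (a (lift ord0 i) * m)) *:
      (x ord0 ^+ m * \prod_(i <- s) x (lift ord0 i) ^+ a (lift ord0 i)).
  elim: s => [|i s IHs]; first by rewrite !big_nil mul1r mulr1 scale1r.
  rewrite !big_cons -mulrA IHs -scalerAr !mulrA (skew_commute_exp _ _ (xx ord0 _ _)) //.
  by rewrite -scalerAl scalerA mulrC.
rewrite mulrA -(mulrA (_ ^+ _)) tail_head -scalerAr -scalerAl mulrA -exprD -mulrA.
rewrite (IH _ (fun i j => w (lift ord0 i) (lift ord0 j))); last first.
  by move=> i j ij; apply: xx; rewrite !lift0 ltnS.
rewrite -scalerAr scalerA; congr (_ * _ *: _).
  by rewrite [RHS]big_mkcond big_ord_recl /= mul1r.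
apply: eq_bigr => i _; rewrite [RHS]big_mkcond big_ord_recl /= mul1r big_mkcond.
by apply: eq_bigr => j _; rewrite /bump !add1n ltnS.
Qed.

End OrderedMonomials.

(** * Roots of unity *)

(** The multiplicative order of c divides a and b, hence their gcd. *)
Lemma expr_gcdn_eq1 (K : fieldType) (c : K) a b :
  (0 < a)%N -> c ^+ a = 1 -> c ^+ b = 1 -> c ^+ gcdn a b = 1.
Proof.
move=> a0 ca cb; have [m cm _] := prim_order_exists a0 ca.
apply/eqP; rewrite -(prim_order_dvd cm) dvdn_gcd !(prim_order_dvd cm).
by rewrite ca cb eqxx.
Qed.

(** In characteristic 0 the polynomial X^m - 1 is separable, so it has m distinct
    roots; a finite group of that many m-th roots of unity is cyclic. *)
Lemma prim_root_exists (K : numClosedFieldType) m :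
  (0 < m)%N -> exists z : K, m.-primitive_root z.
Proof.
move=> m0; have [r Xm1] := closed_field_poly_normal ('X^m - 1 : {poly K}).
move: Xm1; rewrite (monicP (monicXnsubC _ m0)) scale1r => Xm1.
have roots : all m.-unity_root r.
  by apply/allP => z; rewrite -root_prod_XsubC -Xm1.
have r_uniq : uniq r.
  by rewrite -separable_prod_XsubC -Xm1 separable_Xn_sub_1 // pnatr_eq0 -lt0n.
have size_r : (m <= size r)%N.
  by rewrite -ltnS -(size_prod_XsubC r id) -Xm1 size_XnsubC.
by have /hasP[z _ zP] := has_prim_root m0 roots r_uniq size_r; exists z.
Qed.

(** * Bicharacters of a product of cyclic groups *)

Section ProductOfCyclicGroups.
Variables (k : nat) (n : 'I_k -> nat).
Local Notation G := (prod_cyclic n).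
(* The modulus of the i-th factor in the form in which it occurs in its type; it
   is n i when n i is positive. *)
Local Notation q i := (n i).-1.+1.

Lemma prod_cyclicM (g h : G) i : (g * h)%g i = ((g i + h i) %% q i)%N :> nat.
Proof. by rewrite mulg_ffun. Qed.

Lemma prod_cyclic1 i : (1%g : G) i = 0%N :> nat.
Proof. by rewrite oneg_ffun. Qed.

Lemma prod_cyclicC (g h : G) : (g * h = h * g)%g.
Proof. by apply/ffunP => i; rewrite !mulg_ffun Zp_mulgC. Qed.

Definition cyclic_gen (i : 'I_k) : G :=
  @dfung1 'I_k (fun i => 'I_(q i)) i Zp1.

Lemma cyclic_genX i m :
  (cyclic_gen i ^+ m)%g = @dfung1 'I_k (fun i => 'I_(q i)) i (inZp m).
Proof.
rewrite /cyclic_gen -(morphX (@dfung1_morphism 'I_k (fun i => 'I_(q i)) i)) ?inE // Zp_expg.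
by congr (dfung1 _); apply: val_inj; rewrite /= modnMml mul1n.
Qed.

Lemma cyclic_gen_order i : (cyclic_gen i ^+ q i)%g = 1%g.
Proof.
rewrite cyclic_genX (_ : inZp _ = 1%g) ?(morph1 (@dfung1_morphism 'I_k (fun i => 'I_(q i)) i)) //.
by apply: val_inj; rewrite /= modnn.
Qed.

Lemma cyclic_gen_decomposition (g : G) : g = (\prod_i cyclic_gen i ^+ g i)%g.
Proof.
apply/ffunP => j; rewrite prodg_ffun (big_only1 j) //.
  by rewrite cyclic_genX dfung1_id valZpK.
by move=> i ij _; rewrite cyclic_genX dfung1_dflt.
Qed.

Lemma cyclic_gen_val i j : cyclic_gen i j = ((i == j) %% q j)%N :> nat.
Proof.
case: eqVneq => [<- | ij]; first by rewrite dfung1_id.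
by rewrite dfung1_dflt // mod0n.
Qed.

Section Bicharacter.
Variable K : fieldType.
Implicit Type w : 'I_k -> 'I_k -> K.

(** The constraint on the scalars w_ij in v u = w_ij u v, where u and v are
    homogeneous of degrees the i-th and j-th generators. *)
Definition commutation_datum w : Prop :=
  forall i j : 'I_k, (i < j)%N -> w i j ^+ gcdn (q i) (q j) = 1.

Definition bicharacter w (g h : G) : K :=
  \prod_(i < k) \prod_(j < k | (i < j)%N) w i j ^+ (g j * h i).

Section BicharacterTheory.
Variables (w : 'I_k -> 'I_k -> K) (wP : commutation_datum w).

Lemma commutation_datumXl (i j : 'I_k) : (i < j)%N -> w i j ^+ q i = 1.
Proof.
by move=> ij; rewrite -(divnK (dvdn_gcdl (q i) (q j))) mulnC exprM wP // expr1n.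
Qed.

Lemma commutation_datumXr (i j : 'I_k) : (i < j)%N -> w i j ^+ q j = 1.
Proof.
by move=> ij; rewrite -(divnK (dvdn_gcdr (q i) (q j))) mulnC exprM wP // expr1n.
Qed.

(** The coordinates of g g' are only defined modulo the orders of the factors;
    this is harmless because w_ij has order dividing the j-th one.  The i-th one
    plays the same role on the right. *)
Lemma bicharacterMl g g' h :
  bicharacter w (g * g')%g h = bicharacter w g h * bicharacter w g' h.
Proof.
rewrite /bicharacter -big_split; apply: eq_bigr => i _ /=.
rewrite -big_split; apply: eq_bigr => j ij /=.
by rewrite prod_cyclicM exprM expr_mod ?commutation_datumXr // -exprM -exprD mulnDl.
Qed.

Lemma bicharacterMr g h h' :
  bicharacter w g (h * h')%g = bicharacter w g h * bicharacter w g h'.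
Proof.
rewrite /bicharacter -big_split; apply: eq_bigr => i _ /=.
rewrite -big_split; apply: eq_bigr => j ij /=.
rewrite prod_cyclicM mulnC exprM expr_mod ?commutation_datumXl //.
by rewrite -exprM -exprD mulnC mulnDr.
Qed.

Lemma bicharacter_neq0 g h : bicharacter w g h != 0.
Proof.
rewrite prodf_seq_neq0; apply/allP => i _; apply/implyP => _.
rewrite prodf_seq_neq0; apply/allP => j _; apply/implyP => ij.
apply: expf_neq0; apply: contra_eq_neq (commutation_datumXl ij) => ->.
by rewrite expr0n eq_sym oner_neq0.
Qed.

(** Any bimultiplicative map satisfies the cocycle identity: both sides are the
    product of its values at (a, b), (a, c) and (b, c). *)
Lemma bicharacter_cocycle : normalized_cocycle (bicharacter w).
Proof.
split=> [a b | a | a | a b c]; first exact: bicharacter_neq0.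
- rewrite /bicharacter big1 // => i _; rewrite big1 // => j _.
  by rewrite prod_cyclic1.
- rewrite /bicharacter big1 // => i _; rewrite big1 // => j _.
  by rewrite prod_cyclic1 muln0.
- by rewrite bicharacterMl bicharacterMr [RHS]mulrC mulrA.
Qed.

(** The coordinates of a generator are 0 or 1 modulo the order of the factor.  If
    that order is 1 the value 1 is reduced to 0, but then w_ij = 1. *)
Lemma bicharacter_gen (i j : 'I_k) : (i < j)%N ->
  bicharacter w (cyclic_gen j) (cyclic_gen i) = w i j.
Proof.
move=> ij; rewrite /bicharacter (big_only1 i) => // [|i' i'i _]; last first.
  by rewrite big1 // => j' _; rewrite !cyclic_gen_val [i == _]eq_sym (negPf i'i) mod0n muln0.
rewrite (big_only1 j) => // [|j' j'j _]; last first.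
  by rewrite !cyclic_gen_val [j == _]eq_sym (negPf j'j) mod0n.
rewrite !cyclic_gen_val !eqxx exprM.
by rewrite (expr_mod _ (commutation_datumXr ij)) (expr_mod _ (commutation_datumXl ij)).
Qed.

Lemma bicharacter_gen_lt (i j : 'I_k) : (i < j)%N ->
  bicharacter w (cyclic_gen i) (cyclic_gen j) = 1.
Proof.
move=> ij; rewrite /bicharacter big1 // => i' _; rewrite big1 // => j' i'j'.
rewrite !cyclic_gen_val; case: eqVneq => [ij' | _]; last by rewrite mod0n.
case: eqVneq => [ji' | _]; last by rewrite mod0n muln0.
by move: i'j'; rewrite -ij' -ji' ltnNge ltnW.
Qed.

Definition bicharacter_algebra : gradedTwistedAlg K G :=
  twisted_algebra bicharacter_cocycle.

End BicharacterTheory.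

(** The family w, restricted to i < j, is the complete isomorphism invariant. *)
Definition skew_commutation (W : gradedTwistedAlg K G) w : Prop :=
  forall i j : 'I_k, (i < j)%N -> forall u v : W,
    gta_comp (cyclic_gen i) u -> gta_comp (cyclic_gen j) v ->
    gta_mul v u = w i j *: gta_mul u v.

Lemma bicharacter_algebra_skew w (wP : commutation_datum w) :
  skew_commutation (bicharacter_algebra wP) w.
Proof.
move=> i j ij u v ui vj.
rewrite /= (twisted_mul_comp _ vj ui) (twisted_mul_comp _ ui vj).
rewrite bicharacter_gen // bicharacter_gen_lt // mul1r scalerA prod_cyclicC.
by rewrite (mulrC (v _)).
Qed.

Lemma skew_commutation_iso (W V : gradedTwistedAlg K G) w :
  graded_isomorphic W V -> skew_commutation V w -> skew_commutation W w.
Proof.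
move=> [phi [phi_lin phi_bij phiM _ phi_comp]] Vw i j ij u v ui vj.
apply: (bij_inj phi_bij).
have phi0 : phi 0 = 0 by apply: linear_fun0.
have := phi_lin (w i j) (gta_mul u v) 0; rewrite phi0 !addr0 => ->.
by rewrite !phiM; apply: Vw => //; apply: phi_comp.
Qed.

Lemma skew_commutation_unique (W : gradedTwistedAlg K G) w w' :
  skew_commutation W w -> skew_commutation W w' ->
  forall i j : 'I_k, (i < j)%N -> w i j = w' i j.
Proof.
move=> Ww Ww' i j ij.
have [u u0 ui] := gta_dim1 W (cyclic_gen i).
have [v v0 vj] := gta_dim1 W (cyclic_gen j).
have {}ui : gta_comp (cyclic_gen i) u by rewrite ui; exists 1; rewrite ?scale1r.
have {}vj : gta_comp (cyclic_gen j) v by rewrite vj; exists 1; rewrite ?scale1r.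
have := Ww' _ _ ij _ _ ui vj; rewrite (Ww _ _ ij _ _ ui vj) => /eqP.
rewrite -subr_eq0 -scalerBl scaler_eq0 (negPf (gta_nondeg ui vj u0 v0)) orbF.
by rewrite subr_eq0 => /eqP.
Qed.

End Bicharacter.
End ProductOfCyclicGroups.

(** * The invariant determines the algebra *)

Section Classification.
Variables (K : numClosedFieldType) (k : nat) (n : 'I_k -> nat).
Local Notation G := (prod_cyclic n).
Local Notation q i := (n i).-1.+1.

Section AssociativeAlgebra.
Variables (W : gradedTwistedAlg K G) (WA : gta_associative W).
Local Notation A := (assoc_ring WA).

Lemma homogeneous_choice (g : G) : exists2 u : A, u != 0 & assoc_comp g u.
Proof.
have [u u0 gu] := gta_dim1 W g; exists u => //.
by rewrite /assoc_comp gu; exists 1 => //; rewrite scale1r.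
Qed.

Lemma assoc_comp1_scalar (u : A) : assoc_comp 1%g u -> exists a : K, u = a *: 1.
Proof. by move=> u1; apply: gta_comp_line u1; [exact: gta_one_comp | exact: gta_one_neq0]. Qed.

(** If a^m = 1 then u^m is a nonzero multiple of 1, hence commutes with v; but
    moving v across u^m costs c^m.  The same holds with the roles exchanged. *)
Lemma commutator_root_of_unity a b (u v : A) (c : K) m :
  assoc_comp a u -> assoc_comp b v -> u != 0 -> v != 0 ->
  v * u = c *: (u * v) ->
  ((a ^+ m)%g = 1%g -> c ^+ m = 1) /\ ((b ^+ m)%g = 1%g -> c ^+ m = 1).
Proof.
move=> au bv u0 v0 vu.
have scalar_one (s : K) (z : A) : z != 0 -> z = s *: z -> s = 1.
  move=> z0 /eqP; rewrite eq_sym -subr_eq0 -[X in _ - X]scale1r -scalerBl.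
  by rewrite scaler_eq0 (negPf z0) orbF subr_eq0 => /eqP.
split=> [am1 | bm1].
- have [t ut] : exists t : K, u ^+ m = t *: 1.
    by apply: assoc_comp1_scalar; rewrite -am1; apply: assoc_compX.
  have t0 : t *: v != 0.
    rewrite scaler_eq0 (negPf v0) orbF.
    by apply: contraNneq (assoc_exp_neq0 m au u0) => t0; rewrite ut t0 scale0r.
  apply: scalar_one t0 _; have := skew_commute_exp 1 m vu.
  by rewrite expr1 mul1n ut -scalerAr -scalerAl mulr1 mul1r.
- have [t vt] : exists t : K, v ^+ m = t *: 1.
    by apply: assoc_comp1_scalar; rewrite -bm1; apply: assoc_compX.
  have t0 : t *: u != 0.
    rewrite scaler_eq0 (negPf u0) orbF.
    by apply: contraNneq (assoc_exp_neq0 m bv v0) => t0; rewrite vt t0 scale0r.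
  apply: scalar_one t0 _; have := skew_commute_exp m 1 vu.
  by rewrite expr1 muln1 vt -scalerAr -scalerAl mulr1 mul1r.
Qed.

(** As the group is abelian, u v and v u have the same degree, so they are
    proportional; and the factor is unchanged when u and v are rescaled. *)
Lemma skew_commutation_exists :
  exists2 w, commutation_datum n w & skew_commutation W w.
Proof.
have pairP (p : 'I_k * 'I_k) : exists c : K,
    c ^+ gcdn (q p.1) (q p.2) = 1 /\
    forall u v : A, assoc_comp (cyclic_gen n p.1) u ->
      assoc_comp (cyclic_gen n p.2) v -> v * u = c *: (u * v).
  case: p => i j /=.
  have [u u0 ui] := homogeneous_choice (cyclic_gen n i).
  have [v v0 vj] := homogeneous_choice (cyclic_gen n j).
  have uv0 := assoc_mul_neq0 ui vj u0 v0.
  have vu_comp : assoc_comp (cyclic_gen n i * cyclic_gen n j)%g (v * u).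
    by rewrite prod_cyclicC; apply: assoc_compM.
  have [c vu] := gta_comp_line (assoc_compM ui vj) uv0 vu_comp.
  exists c; split.
    apply: expr_gcdn_eq1 => //.
      apply: (proj1 (commutator_root_of_unity _ ui vj u0 v0 vu)).
      exact: cyclic_gen_order.
    apply: (proj2 (commutator_root_of_unity _ ui vj u0 v0 vu)).
    exact: cyclic_gen_order.
  move=> u' v' /(gta_comp_line ui u0)[s ->] /(gta_comp_line vj v0)[t ->].
  suff: (t *: v : A) * (s *: u) = c *: ((s *: u) * (t *: v)) by [].
  rewrite -!scalerAl -!scalerAr [v * u]vu !scalerA.
  by rewrite mulrC (mulrC t) mulrA.
have [c cP] := choice pairP.
exists (fun i j => c (i, j)) => i j ij; first exact: (cP (i, j)).1.
exact: (cP (i, j)).2.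
Qed.

(** The n_i-th power of a generator is a scalar, so dividing the generator by an
    n_i-th root of this scalar makes the power equal to 1. *)
Lemma normalized_generator i : exists x : A,
  [/\ x != 0, assoc_comp (cyclic_gen n i) x & x ^+ q i = 1].
Proof.
have [u u0 ui] := homogeneous_choice (cyclic_gen n i).
have [c uc] : exists c : K, u ^+ q i = c *: 1.
  apply: assoc_comp1_scalar; rewrite -(cyclic_gen_order n i).
  exact: assoc_compX.
have c0 : c != 0.
  by apply: contraNneq (assoc_exp_neq0 (q i) ui u0) => c0; rewrite uc c0 scale0r.
pose r := (q i).-root c; have rX : r ^+ q i = c by rewrite rootCK.
have r0 : r != 0 by apply: contraNneq c0 => r0; rewrite -rX r0 expr0n.
exists (r^-1 *: u); split.
- by rewrite scaler_eq0 invr_eq0 negb_or r0.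
- exact: gta_comp_scale.
- by rewrite exprZn uc exprVn rX scalerA mulVf // scale1r.
Qed.

(** With normalized generators, the exponents in an ordered monomial only matter
    modulo the orders of the factors, so b_g b_h is a multiple of b_(gh). *)
Lemma bicharacter_algebra_complete w (wP : commutation_datum n w) :
  skew_commutation W w -> graded_isomorphic W (bicharacter_algebra wP).
Proof.
move=> Ww; have [x xP] := choice normalized_generator.
have x0 i : x i != 0 by case: (xP i).
have x_comp i : assoc_comp (cyclic_gen n i) (x i) by case: (xP i).
have xq i : x i ^+ q i = 1 by case: (xP i).
pose b (g : G) : A := \prod_i x i ^+ g i.
apply: (@twisted_algebra_iso _ _ _ _ W b).
- move=> g; rewrite {1}(cyclic_gen_decomposition g).
  by apply: (@assoc_comp_prod _ _ _ WA) => i; apply: assoc_compX.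
- move=> g; apply: (@assoc_prod_neq0 _ _ _ WA _ _ (fun i => cyclic_gen n i ^+ g i)%g).
    by move=> i; apply: assoc_compX.
  by move=> i; apply: assoc_exp_neq0 (x_comp i) (x0 i).
- by rewrite /b big1 // => i _; rewrite prod_cyclic1.
- move=> g h; have xx (i j : 'I_k) : (i < j)%N -> x j * x i = w i j *: (x i * x j).
    by move=> ij; exact: (Ww _ _ ij _ _ (x_comp i) (x_comp j)).
  have := ordered_monomial_mul (fun i => g i : nat) (fun i => h i : nat) xx.
  rewrite -/(bicharacter w g h) => bb.
  rewrite [LHS]bb; congr (_ *: _); apply: eq_bigr => i _.
  by rewrite prod_cyclicM expr_mod.
Qed.

End AssociativeAlgebra.

(** * Counting the invariants *)

(** The value 1 at the pairs with i >= j leaves a single exponent there, so that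
    these pairs do not contribute to the count. *)
Definition pair_order (p : 'I_k * 'I_k) : nat :=
  if (p.1 < p.2)%N then gcdn (q p.1) (q p.2) else 1%N.

Local Notation exponents := {dffun forall p : 'I_k * 'I_k, 'I_(pair_order p)}.

Lemma card_exponents :
  #|{: exponents}| = (\prod_(i < k) \prod_(j < k | (i < j)%N) gcdn (q i) (q j))%N.
Proof.
rewrite card_dep_ffun foldrE big_map big_enum /=.
under eq_bigr do rewrite card_ord.
rewrite pair_big_dep /= [RHS]big_mkcond /=.
by apply: eq_bigr => -[i j] _; rewrite /pair_order.
Qed.

Variables (zeta : nat -> K) (zetaP : forall m, (0 < m)%N -> m.-primitive_root (zeta m)).

Definition exponent_datum (c : exponents) (i j : 'I_k) : K :=
  zeta (pair_order (i, j)) ^+ c (i, j).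

Lemma pair_order_gt0 p : (0 < pair_order p)%N.
Proof. by rewrite /pair_order; case: ifP => // _; rewrite gcdn_gt0. Qed.

Lemma exponent_datumP c : commutation_datum n (exponent_datum c).
Proof.
move=> i j ij; rewrite /exponent_datum exprAC.
have -> : gcdn (q i) (q j) = pair_order (i, j) by rewrite /pair_order ij.
by rewrite (prim_expr_order (zetaP (pair_order_gt0 _))) expr1n.
Qed.

Lemma exponent_datum_inj c c' :
  (forall i j : 'I_k, (i < j)%N -> exponent_datum c i j = exponent_datum c' i j) ->
  c = c'.
Proof.
move=> cc'; apply/ffunP => -[i j]; apply: val_inj => /=.
have [ij | ij] := ltnP i j.
  have /eqP := cc' _ _ ij; rewrite (eq_prim_root_expr (zetaP (pair_order_gt0 (i, j)))).
  by rewrite !modn_small // => /eqP.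
have e1 : pair_order (i, j) = 1%N by rewrite /pair_order /= ltnNge ij.
have := ltn_ord (c (i, j)); have := ltn_ord (c' (i, j)).
by rewrite [X in (_ < X)%N]e1 [X in _ -> (_ < X)%N -> _]e1 !ltnS !leqn0 => /eqP -> /eqP ->.
Qed.

Lemma exponent_datum_surj w : commutation_datum n w ->
  exists c, forall i j : 'I_k, (i < j)%N -> w i j = exponent_datum c i j.
Proof.
move=> wP.
have wz p : {c : 'I_(pair_order p) |
    (p.1 < p.2)%N -> w p.1 p.2 = zeta (pair_order p) ^+ c}.
  have [ij | ij] := ltnP p.1 p.2; last first.
    by exists (Ordinal (pair_order_gt0 p)).
  have wp : w p.1 p.2 ^+ pair_order p = 1 by rewrite /pair_order ij wP.
  by have [c cP] := prim_rootP (zetaP (pair_order_gt0 p)) wp; exists c.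
exists [ffun p => sval (wz p)] => i j ij; rewrite /exponent_datum ffunE.
exact: (svalP (wz (i, j))) ij.
Qed.

End Classification.

Lemma has_exactly_classes_finType (T : Type) (P : T -> Prop) (E : T -> T -> Prop)
    (I : finType) (A : I -> T) :
  (forall i, P (A i)) -> (forall i j, E (A i) (A j) -> i = j) ->
  (forall x, P x -> exists i, E x (A i)) -> has_exactly_classes P E #|I|.
Proof.
move=> AP Ainj Asurj; exists (fun i => A (enum_val i)); split=> [i | i j | x].
- exact: AP.
- by move=> /Ainj; apply: enum_val_inj.
- by move=> /Asurj[i xi]; exists (enum_rank i); rewrite enum_rankK.
Qed.

Local Close Scope ring_scope.

Theorem mainTheorem2 (R : realType) (k : nat) (n : 'I_k -> nat)
    (n_gt0 : forall i : 'I_k, 0 < n i) :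
  has_exactly_classes
    (@gta_associative R[i] (prod_cyclic n))
    (@graded_isomorphic R[i] (prod_cyclic n))
    (\prod_(i < k) \prod_(j < k | i < j) gcdn (n i) (n j)).
Proof.
have zeta_exists m : exists z : R[i], 0 < m -> (m.-primitive_root z)%R.
  have [-> | m0] := posnP m; first by exists 1%R.
  by have [z zP] := @prim_root_exists R[i] m m0; exists z.
have [zeta zetaP] := choice zeta_exists.
have -> : \prod_(i < k) \prod_(j < k | i < j) gcdn (n i) (n j) =
    #|{: {dffun forall p : 'I_k * 'I_k, 'I_(pair_order n p)}}|.
  rewrite card_exponents; apply: eq_bigr => i _; apply: eq_bigr => j _.
  by rewrite !prednK.
apply: (has_exactly_classes_finType
  (A := fun c => bicharacter_algebra (exponent_datumP zetaP c))).
- by move=> c; apply: twisted_algebra_associative.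
- move=> c c' cc'; apply: (exponent_datum_inj zetaP).
  have skew c0 := @bicharacter_algebra_skew _ n _ _ (exponent_datumP zetaP c0).
  exact: skew_commutation_unique (skew c) (skew_commutation_iso cc' (skew c')).
- move=> W WA; have [w wP Ww] := skew_commutation_exists WA.
  have [c wc] := exponent_datum_surj zetaP wP.
  exists c; apply: bicharacter_algebra_complete => // i j ij u v ui vj.
  by rewrite -wc //; apply: Ww.
Qed.
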